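(* For $k\ge1$ let $N_k=3^k+1$ and $L_k=\frac12(3^k-1)$. (1) For $1\le k_1<k_2<\cdots<k_n$, $$\dim_H(\mathcal{C}(1,N_{k_1},N_{k_2},\ldots,N_{k_n}))\ge\dim_H(\mathcal{C}(1,L_{k_n+1})).$$ Equality holds when $k_j=j$ for $1\le j\le n$. (2) For each fixed $n\ge1$, $$\liminf_{k\to\infty}\dim_H(\mathcal{C}(1,N_k,N_{k+1},\ldots,N_{k+n-1}))\ge\tfrac12\log_3 2\approx0.315464.$$ In particular, $\Gamma_\star\ge\frac12\log_3 2$.
   Context: $\mathbb{Z}_3$ denotes the $3$-adic integers with the $3$-adic metric ($|3|_3=1/3$), and $\dim_H$ is Hausdorff dimension with respect to it. $\Sigma_3\subset\mathbb{Z}_3$ is the set of all $\sum_{j\ge0}a_j3^j$ with every $a_j\in\{0,1\}$. For positive integers $M_1,\ldots,M_n$, $\mathcal{C}(1,M_1,\ldots,M_n)=\{\lambda\in\Sigma_3:M_i\lambda\in\Sigma_3\text{ for all }i\}$. For $k\ge1$, $\mathcal{E}_\star^{(k)}(\mathbb{Z}_3)$ is the set of $\lambda\in\mathbb{Z}_3$ for which there exist integers $1=M_1<M_2<\cdots<M_k$, all $M_i\equiv1\pmod3$, with $M_i\lambda\in\Sigma_3$ for all $1\le i\le k$. These sets are nested decreasing in $k$, and $\Gamma_\star:=\lim_{k\to\infty}\dim_H(\mathcal{E}_\star^{(k)}(\mathbb{Z}_3))$. *)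

(* Defs.v *)
From HB Require Import structures.
From mathcomp Require Import all_boot all_order all_algebra.
From mathcomp Require Import all_classical all_reals all_analysis.

Set Implicit Arguments.
Unset Strict Implicit.
Unset Printing Implicit Defensive.

Import Order.TTheory GRing.Theory Num.Theory.
Import numFieldNormedType.Exports.

Local Open Scope classical_set_scope.
Local Open Scope ring_scope.

Section Hausdorff.
Context {R : realType} {T : metricType R}.
Local Open Scope ereal_scope.
Implicit Types (A U : set T) (s : R).

(* The supremum of the empty set is -oo; the maximum makes diam set0 = 0. *)
Definition diam U : \bar R :=
  Order.max 0 (ereal_sup [set (mdist x y)%:E | x in U & y in U]).

(* The case distinction only matters for s = 0, where powers equal 1: the
   empty set contributes 0, so finite covers may be padded with set0. *)
Definition diam_pow s U : \bar R := if `[< U = set0 >] then 0 else diam U `^ s.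

Definition hausdorff_pre s (delta : R) A : \bar R :=
  ereal_inf [set \sum_(0 <= i <oo) diam_pow s (U i) | U in
    [set U : (set T)^nat |
      A `<=` \bigcup_i U i /\ forall i, diam (U i) <= delta%:E]].

Definition hausdorff_measure s A : \bar R :=
  ereal_sup [set hausdorff_pre s delta A | delta in [set d : R | (0 < d)%R]].

Definition hausdorff_dim A : \bar R :=
  ereal_inf [set s%:E | s in [set s : R | (0 <= s)%R /\
                                          hausdorff_measure s A = 0]].

End Hausdorff.

(* Inverse limit of the rings Z / 3^n Z, whose elements are represented by
   their least nonnegative residues: [res x n] is x modulo 3^n. *)
Record Z3 := MkZ3 {
  res : nat -> int;
  res_compat : forall n, res n = (res n.+1 %% (3 ^+ n))%Z }.

Lemma Z3_eqP (x y : Z3) : (forall n, res x n = res y n) -> x = y.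
Proof.
case: x y => [f fP] [g gP] /= /funext fg; subst g.
by congr MkZ3; exact: Prop_irrelevance.
Qed.

Lemma res_mod (x : Z3) n : (res x n %% (3 ^+ n))%Z = res x n.
Proof. by rewrite res_compat modz_mod. Qed.

Lemma res0 (x : Z3) : res x 0 = 0.
Proof. by rewrite res_compat expr0 modz1. Qed.

Lemma res_le (x y : Z3) m n :
  (m <= n)%N -> res x n = res y n -> res x m = res y m.
Proof.
by elim: n => [|n IH]; rewrite leq_eqVlt => /predU1P[-> //|] //;
  rewrite ltnS => mn xy; apply: IH => //; rewrite !(res_compat _ n) xy.
Qed.

Section Z3_make.
Variable f : nat -> int.
Hypothesis fP : forall n, (f n = f n.+1 %[mod 3 ^+ n])%Z.

Fact Z3_make_subproof n :
  (f n %% (3 ^+ n))%Z = ((f n.+1 %% (3 ^+ n.+1))%Z %% (3 ^+ n))%Z.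
Proof.
rewrite fP {1}(divz_eq (f n.+1) (3 ^+ n.+1)) {2}exprS mulrA.
by rewrite modzMDl.
Qed.

Definition Z3_make := MkZ3 Z3_make_subproof.
End Z3_make.

Lemma res_modS (x : Z3) n : (res x n = res x n.+1 %[mod 3 ^+ n])%Z.
Proof. by rewrite -res_compat res_mod. Qed.

Fact Z3_nat_subproof (z : int) n : ((fun=> z) n = (fun=> z) n.+1 %[mod 3 ^+ n])%Z.
Proof. by []. Qed.

Fact Z3_opp_subproof x n : (- res x n = - res x n.+1 %[mod 3 ^+ n])%Z.
Proof. by rewrite -modzNm res_modS modzNm. Qed.

Fact Z3_add_subproof x y n :
  (res x n + res y n = res x n.+1 + res y n.+1 %[mod 3 ^+ n])%Z.
Proof. by rewrite -modzDm !res_modS modzDm. Qed.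

Fact Z3_mul_subproof x y n :
  (res x n * res y n = res x n.+1 * res y n.+1 %[mod 3 ^+ n])%Z.
Proof. by rewrite -modzMm !res_modS modzMm. Qed.

Definition Z3_int z := Z3_make (Z3_nat_subproof z).
Definition Z3_opp x := Z3_make (Z3_opp_subproof x).
Definition Z3_add x y := Z3_make (Z3_add_subproof x y).
Definition Z3_mul x y := Z3_make (Z3_mul_subproof x y).

HB.instance Definition _ := gen_eqMixin Z3.
HB.instance Definition _ := gen_choiceMixin Z3.

Fact Z3_addA : associative Z3_add.
Proof. by move=> x y z; apply: Z3_eqP => n /=; rewrite modzDmr modzDml addrA. Qed.

Fact Z3_addC : commutative Z3_add.
Proof. by move=> x y; apply: Z3_eqP => n /=; rewrite addrC. Qed.

Fact Z3_add0 : left_id (Z3_int 0) Z3_add.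
Proof. by move=> x; apply: Z3_eqP => n /=; rewrite modzDml add0r res_mod. Qed.

Fact Z3_addN : left_inverse (Z3_int 0) Z3_opp Z3_add.
Proof. by move=> x; apply: Z3_eqP => n /=; rewrite modzDml addNr. Qed.

HB.instance Definition _ :=
  GRing.isZmodule.Build Z3 Z3_addA Z3_addC Z3_add0 Z3_addN.

Fact Z3_mulA : associative Z3_mul.
Proof. by move=> x y z; apply: Z3_eqP => n /=; rewrite modzMmr modzMml mulrA. Qed.

Fact Z3_mulC : commutative Z3_mul.
Proof. by move=> x y; apply: Z3_eqP => n /=; rewrite mulrC. Qed.

Fact Z3_mul1 : left_id (Z3_int 1) Z3_mul.
Proof. by move=> x; apply: Z3_eqP => n /=; rewrite modzMml mul1r res_mod. Qed.

Fact Z3_mulD : left_distributive Z3_mul Z3_add.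
Proof.
by move=> x y z; apply: Z3_eqP => n /=; rewrite modzMml modzDm mulrDl.
Qed.

Fact Z3_1neq0 : Z3_int 1 != 0.
Proof. by apply/eqP => /(congr1 (res^~ 1%N)). Qed.

HB.instance Definition _ := GRing.Zmodule_isComNzRing.Build Z3
  Z3_mulA Z3_mulC Z3_mul1 Z3_mulD Z3_1neq0.

Lemma res_sub_eq0 (x y : Z3) n : (res (x - y) n = 0) <-> (res x n = res y n).
Proof.
rewrite /= modzDmr; split=> [/dvdz_mod0P xy|->]; last by rewrite subrr mod0z.
by rewrite -(res_mod x) -(res_mod y); apply/eqP; rewrite eqz_mod_dvd.
Qed.

(* For x != 0 the valuation of x is the least n with x <> 0 modulo 3^(n+1). *)
Definition norm3 (R : realType) (x : Z3) : R :=
  if pselect (exists n, res x n.+1 != 0) is left ex then 3 ^- ex_minn ex else 0.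

Definition dist3 (R : realType) (x y : Z3) : R := norm3 R (x - y).

Section norm3_theory.
Context {R : realType}.
Implicit Types x y z : Z3.

Lemma norm3_ge0 x : 0 <= norm3 R x.
Proof. by rewrite /norm3; case: pselect => // ?; rewrite invr_ge0 exprn_ge0. Qed.

Lemma norm3_lt x n : (norm3 R x < 3 ^- n) = (res x n.+1 == 0).
Proof.
rewrite /norm3; case: pselect => [ex|nex]; last first.
  rewrite invr_gt0 exprn_gt0//; apply/esym.
  by apply: contrapT => /negP xn; apply: nex; exists n.
case: ex_minnP => m xm mmin.
rewrite ltf_pV2 ?posrE ?exprn_gt0// ltr_eXn2l ?ltr1n//.
apply/idP/eqP => [nm|xn].
  by apply/eqP; apply: contraLR nm => /mmin; rewrite -leqNgt.
rewrite ltnNge; apply: contra xm => mn; apply/eqP.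
rewrite (@res_le x 0 m.+1 n.+1)//; first by rewrite /= mod0z.
by rewrite xn /= mod0z.
Qed.

Lemma norm3_3 : norm3 R 3 = 3^-1.
Proof.
rewrite /norm3; case: pselect => [ex|[]]; last by exists 1%N.
case: ex_minnP => -[|[|m]] // m2 /(_ 1%N isT).
by rewrite ltnS ltn0.
Qed.

Lemma norm3_eq0 x : (norm3 R x == 0) = (x == 0).
Proof.
apply/eqP/eqP => [x0|->].
  apply: Z3_eqP => -[|n]; first by rewrite !res0.
  by have := norm3_lt x n; rewrite x0 invr_gt0 exprn_gt0// => /esym/eqP->;
    rewrite /= mod0z.
by rewrite /norm3; case: pselect => // ex; exfalso; case: ex => n; rewrite /= mod0z.
Qed.

Lemma dist3_lt x y n : dist3 R x y < 3 ^- n <-> res x n.+1 = res y n.+1.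
Proof. by rewrite /dist3 norm3_lt -res_sub_eq0; split => /eqP. Qed.

Lemma dist3_ge0 x y : 0 <= dist3 R x y. Proof. exact: norm3_ge0. Qed.

Lemma dist3xx x : dist3 R x x = 0.
Proof. by rewrite /dist3 subrr; apply/eqP; rewrite norm3_eq0. Qed.

Lemma dist3_eq0 x y : dist3 R x y = 0 -> x = y.
Proof. by move/eqP; rewrite norm3_eq0 subr_eq0 => /eqP. Qed.

Lemma norm3_val x : norm3 R x = 0 \/ exists n, norm3 R x = 3 ^- n.
Proof.
by rewrite /norm3; case: pselect => [ex|]; [right; eexists|left].
Qed.

Lemma dist3_sym x y : dist3 R x y = dist3 R y x.
Proof.
suff le a b : dist3 R a b <= dist3 R b a by apply/eqP; rewrite eq_le !le.
rewrite {1}/dist3; case: (norm3_val (a - b)) => [->|[n abn]].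
  exact: norm3_ge0.
rewrite abn leNgt; apply/negP => /dist3_lt/esym/dist3_lt.
by rewrite /dist3 abn ltxx.
Qed.

Lemma dist3_ultra y x z : dist3 R x z <= Num.max (dist3 R x y) (dist3 R y z).
Proof.
case: (norm3_val (x - z)) => [xz0|[n xzn]].
  by rewrite /dist3 xz0 le_max norm3_ge0.
rewrite {1}/dist3 xzn leNgt gt_max; apply/negP => /andP[/dist3_lt xy /dist3_lt yz].
have /dist3_lt : res x n.+1 = res z n.+1 by rewrite xy.
by rewrite /dist3 xzn ltxx.
Qed.

Lemma dist3_triangle y x z : dist3 R x z <= dist3 R x y + dist3 R y z.
Proof.
by apply: le_trans (dist3_ultra y x z) _;
  rewrite ge_max lerDl lerDr !norm3_ge0.
Qed.

End norm3_theory.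

(* The uniform structure does not mention R, so that Z3 is a metricType R for
   every R : realType. *)
Definition Z3_entourage : set_system (Z3 * Z3) :=
  filter_from [set: nat] (fun n => [set xy | res xy.1 n = res xy.2 n]).

Fact Z3_entourage_filter : Filter Z3_entourage.
Proof.
apply: filter_from_filter; first by exists 0%N.
move=> i j _ _; exists (maxn i j) => // -[x y] /= xy.
by split=> /=; apply: res_le xy; rewrite ?leq_maxl ?leq_maxr.
Qed.

Fact Z3_entourage_diagonal A : Z3_entourage A -> diagonal `<=` A.
Proof. by move=> [n _ nA] [x y] xy; apply: nA; congr (res _ n); exact: xy. Qed.

Fact Z3_entourage_inv A : Z3_entourage A -> Z3_entourage (A^-1)%relation.
Proof. by move=> [n _ nA]; exists n => // -[x y] /= xy; apply: nA. Qed.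

Fact Z3_entourage_split A :
  Z3_entourage A -> exists2 B, Z3_entourage B & (B \; B `<=` A)%relation.
Proof.
move=> [n _ nA]; exists [set xy | res xy.1 n = res xy.2 n]; first by exists n.
by move=> [x z] [y /= xy yz]; apply: nA; rewrite /= xy.
Qed.

HB.instance Definition _ := isUniform.Build Z3 Z3_entourage_filter
  Z3_entourage_diagonal Z3_entourage_inv Z3_entourage_split.

Section Z3_metric.
Context {R : realType}.

Let ball3 (x : Z3) (e : R) : set Z3 := [set y | dist3 R x y < e].

Fact ball3_center x (e : R) : 0 < e -> ball3 x e x.
Proof. by rewrite /ball3/= dist3xx. Qed.

Fact ball3_sym x y (e : R) : ball3 x e y -> ball3 y e x.
Proof. by rewrite /ball3/= dist3_sym. Qed.

Fact ball3_triangle x y z (e1 e2 : R) :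
  ball3 x e1 y -> ball3 y e2 z -> ball3 x (e1 + e2) z.
Proof.
by rewrite /ball3/= => xy yz; rewrite (le_lt_trans (dist3_triangle y _ _))// ltrD.
Qed.

Fact ball3_entourage : @entourage Z3 = entourage_ ball3.
Proof.
apply/seteqP; split=> A.
  move=> [n _ nA]; exists (3 ^- n); first by rewrite /= invr_gt0 exprn_gt0.
  by move=> [x y] /= /dist3_lt xy; apply: nA => /=; exact: res_le xy.
move=> [e /= e0 eA].
have [n ne] : exists n, 3 ^- n < e.
  have h : \forall n \near \oo, `|0 - (3^-1 : R) ^+ n| < e.
    have /cvgr_dist_lt : (fun n => (3^-1 : R) ^+ n) @ \oo --> (0 : R).
      by apply: cvg_expr; rewrite gtr0_norm ?invf_lt1 ?ltr1n ?invr_gt0.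
    by apply.
  have [n _ /(_ n (leqnn n))] := h.
  by rewrite /= sub0r normrN ger0_norm ?exprn_ge0 ?invr_ge0// exprVn; exists n.
exists n.+1 => // -[x y] /= xy; apply: eA => /=; apply: lt_trans ne.
exact/dist3_lt.
Qed.

HB.instance Definition _ := Uniform_isPseudoMetric.Build R Z3
  ball3_center ball3_sym ball3_triangle ball3_entourage.

Fact ball3E x (d : R) : ball x d = [set y | dist3 R x y < d].
Proof. by []. Qed.

HB.instance Definition _ := PseudoMetric_isMetric.Build R Z3
  (@dist3_ge0 R) (@dist3_eq0 R) ball3E.

End Z3_metric.

Definition Sigma3 : set Z3 :=
  [set x | exists2 a : nat -> nat, (forall j, (a j < 2)%N) &
    series (fun j => (a j)%:R * 3 ^+ j : Z3) @ \oo --> x].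

(* [C1 Ms] is C(1, M_1, ..., M_n) for Ms = [:: M_1; ...; M_n]. *)
Definition C1 (Ms : seq nat) : set Z3 :=
  [set x | Sigma3 x /\ forall m, m \in Ms -> Sigma3 (m%:R * x)].

Definition Estar (k : nat) : set Z3 :=
  [set x | exists M : k.-tuple nat,
    [/\ head 0%N M = 1%N, sorted ltn M &
        forall m, m \in M -> (m = 1 %[mod 3])%N /\ Sigma3 (m%:R * x)]].

Definition dim3 (R : realType) (A : set Z3) : \bar R := hausdorff_dim A.

Definition Gamma_star (R : realType) : \bar R :=
  limn (fun k => dim3 R (Estar k)).

Definition Nk (k : nat) : nat := (3 ^ k + 1)%N.
Definition Lk (k : nat) : nat := ((3 ^ k - 1) %/ 2)%N.

Definition log3 (R : realType) (x : R) : R := ln x / ln 3.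

(* Main.v *)
Require Import Defs.
From HB Require Import structures.
From mathcomp Require Import all_boot all_order all_algebra.
From mathcomp Require Import all_classical all_reals all_analysis.
From mathcomp Require Import zify ring lra.

(* Multiplying a 0/1 expansion by N_k adds two digits in each place, so no carry
   ever occurs: N_k lambda is in Sigma_3 iff no two ones of lambda are at distance
   k. For L_k each place receives the sum of a window of k consecutive digits; this
   sum grows by at most one from a place to the next, so it would have to pass
   through 2 before producing a carry, and L_k lambda is in Sigma_3 iff any two ones
   are at distance at least k. Hence C(1, L_{n+1}) = C(1, N_1, ..., N_n) as sets, and
   (1) is monotonicity of the dimension.

   For (2), repeat blocks of k free digits followed by k + n zeros: no two ones are
   at a distance in [k, k + n), and the mass distribution principle gives a dimension
   at least k / (2k + n) log_3 2, which tends to (log_3 2) / 2. Since N_j = 1 mod 3 for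
   j >= 1, the set E_star^(n + 1) contains C(1, N_k, ..., N_{k+n-1}) for every k >= 1. *)

Set Implicit Arguments.
Unset Strict Implicit.
Unset Printing Implicit Defensive.

Import Order.TTheory GRing.Theory Num.Theory.
Import numFieldNormedType.Exports.

Local Open Scope classical_set_scope.
Local Open Scope ring_scope.

(** * Base 3 digit sums and expansions in [Z3] *)

Definition digsum (a : nat -> nat) (n : nat) : nat :=
  (\sum_(j < n) a j * 3 ^ j)%N.

Lemma digsumS a n : digsum a n.+1 = (digsum a n + a n * 3 ^ n)%N.
Proof. by rewrite /digsum big_ord_recr. Qed.

Lemma digsumD a b n :
  digsum (fun j => a j + b j)%N n = (digsum a n + digsum b n)%N.
Proof. by rewrite /digsum -big_split; apply: eq_bigr => j _; rewrite mulnDl. Qed.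

Lemma digsum_ltn a n :
  (forall j, (j < n)%N -> (a j < 3)%N) -> (digsum a n < 3 ^ n)%N.
Proof.
elim: n => [|n IH] a3; first by rewrite /digsum big_ord0.
have := IH (fun j jn => a3 j (ltnW jn)); have := a3 n (leqnn _).
by rewrite digsumS expnS; nia.
Qed.

Lemma digsum_modn a m n : (m <= n)%N -> digsum a n = digsum a m %[mod 3 ^ m].
Proof.
elim: n => [|n IH]; rewrite leq_eqVlt => /predU1P[->//|] //.
rewrite ltnS => mn; rewrite digsumS -IH//.
have -> : (3 ^ n = 3 ^ (n - m) * 3 ^ m)%N by rewrite -expnD subnK.
by rewrite mulnA addnC modnMDl.
Qed.

(** Digits at most 2 keep both sums below 3^(n+1), so the congruence is an equality, and the top
    digit is the quotient by 3^n. *)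
Lemma digsum_inj a b n :
  (forall j, (j <= n)%N -> (a j < 3)%N) ->
  (forall j, (j <= n)%N -> (b j < 3)%N) ->
  digsum a n.+1 = digsum b n.+1 %[mod 3 ^ n.+1] -> a n = b n.
Proof.
move=> a3 b3; rewrite !modn_small ?digsum_ltn// !digsumS => ab.
have aE : ((digsum a n + a n * 3 ^ n) %/ 3 ^ n)%N = a n.
  by rewrite addnC divnMDl ?expn_gt0// divn_small ?addn0// digsum_ltn// => j /ltnW/a3.
by rewrite -aE ab addnC divnMDl ?expn_gt0// divn_small ?addn0// digsum_ltn// => j /ltnW/b3.
Qed.

(* The digits may exceed 2: [b] is an expansion before carrying. *)
Definition represents (x : Z3) (b : nat -> nat) :=
  forall n, res x n = (digsum b n %% 3 ^ n)%N.

Lemma modz_pow3 (m n : nat) : (m%:Z %% (3 ^+ n))%Z = (m %% 3 ^ n)%N.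
Proof. by rewrite -modz_nat -[Posz (3 ^ n)]natz natrX. Qed.

Lemma res_natr m n : res m%:R n = (m %% 3 ^ n)%N.
Proof.
rewrite -modz_pow3; elim: m => [|m IH] //.
by rewrite mulrS /= IH modzDm intS.
Qed.

(** Convergence in [Z3] means that residues modulo each 3^n stabilize, and from index n on all
    partial sums agree with [digsum a n] modulo 3^n. *)
Lemma Sigma3P x :
  Sigma3 x <-> exists2 a, (forall j, (a j < 2)%N) & represents x a.
Proof.
have resE (a : nat -> nat) N n :
    res (series (fun j => (a j)%:R * 3 ^+ j : Z3) N) n = (digsum a N %% 3 ^ n)%N.
  rewrite -res_natr; congr (res _ _); rewrite /series /= /digsum big_mkord.
  by rewrite natr_sum; apply: eq_bigr => j _; rewrite natrM natrX.
split=> -[a a2 xa]; exists a => //.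
  move=> n; have := (cvg_entourageP _ _).1 xa [set xy | res xy.1 n = res xy.2 n].
  case=> [|N _ /(_ (maxn N n) (leq_maxl _ _)) /= ->]; first by exists n.
  by rewrite resE; congr Posz; apply: digsum_modn; exact: leq_maxr.
apply/cvg_entourageP => A [n _ nA]; exists n => // N /= nN.
by apply: nA; rewrite /= resE xa; congr Posz; rewrite digsum_modn.
Qed.

Lemma representsD x y a b : represents x a -> represents y b ->
  represents (x + y) (fun j => a j + b j)%N.
Proof.
by move=> xa yb n; rewrite /= xa yb -PoszD modz_pow3 digsumD modnDm.
Qed.

Definition shiftn i (a : nat -> nat) j := if (i <= j)%N then a (j - i)%N else 0%N.

Lemma digsum_shiftn i a n :
  digsum (shiftn i a) (i + n) = (3 ^ i * digsum a n)%N.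
Proof.
elim: n => [|n IH].
  rewrite addn0 /digsum big_ord0 muln0 big1// => j _.
  by rewrite /shiftn leqNgt ltn_ord.
by rewrite addnS !digsumS IH /shiftn leq_addr addKn mulnDr mulnCA expnD.
Qed.

Lemma represents_shiftn x a i : represents x a ->
  represents ((3 ^ i)%:R * x) (shiftn i a).
Proof.
move=> xa n.
transitivity ((res (3 ^ i)%N%:R n * res x n) %% 3 ^+ n)%Z => //.
rewrite res_natr xa -PoszM modz_pow3 modnMm -digsum_shiftn.
by rewrite (@digsum_modn _ n (i + n))// leq_addl.
Qed.

(** These are the digits, before carrying, of the product of x by the sum of 3^i over i in [S], when
    [a] is an expansion of x. *)
Definition convn (S : seq nat) (a : nat -> nat) j : nat :=
  (\sum_(i <- S) shiftn i a j)%N.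

Lemma represents_convn x a S : represents x a ->
  represents ((\sum_(i <- S) 3 ^ i)%N%:R * x) (convn S a).
Proof.
move=> xa; elim: S => [|i S IH].
  move=> n; rewrite big_nil mul0r /= mod0z /digsum big1 ?mod0n// => j _.
  by rewrite /convn big_nil.
rewrite big_cons natrD mulrDl.
rewrite (_ : convn _ _ = fun j => shiftn i a j + convn S a j)%N.
  exact: representsD (represents_shiftn i xa) IH.
by apply/funext => j; rewrite /convn big_cons.
Qed.

(* Under this growth condition the expansion [b] never produces a carry, so the
   digits of [x] can be read off [b]. *)
Lemma Sigma3_represents x b : represents x b ->
  (forall j, (forall i, (i < j)%N -> (b i < 2)%N) -> (b j < 3)%N) ->
  Sigma3 x <-> forall j, (b j < 2)%N.
Proof.
move=> xb bS; split=> [/Sigma3P[c c2 xc] j|b2]; last by apply/Sigma3P; exists b.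
elim/ltn_ind: j => j IH; rewrite (_ : b j = c j)//.
apply: digsum_inj => [i|i _|].
- by rewrite leq_eqVlt => /predU1P[->|/IH/ltnW//]; apply: bS.
- exact: ltnW (c2 i).
- by have := xb j.+1; rewrite xc => -[].
Qed.

(** * Digit criteria for multiplication by [Nk k] and [Lk k] *)

Lemma Nk_sum k : Nk k = (\sum_(i <- [:: 0; k]) 3 ^ i)%N.
Proof. by rewrite !big_cons big_nil addn0 addnC. Qed.

Lemma Sigma3_Nk x a k : (forall j, (a j < 2)%N) -> represents x a ->
  Sigma3 ((Nk k)%:R * x) <-> forall j, (a j + a (j + k) < 2)%N.
Proof.
move=> a2 xa; have cE j : convn [:: 0%N; k] a j = (a j + shiftn k a j)%N.
  by rewrite /convn !big_cons big_nil addn0 {1}/shiftn subn0.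
rewrite Nk_sum (Sigma3_represents (represents_convn [:: 0%N; k] xa)).
  split=> aP j.
    by have := aP (j + k)%N; rewrite cE /shiftn leq_addl addnK addnC.
  rewrite cE /shiftn; case: (leqP k j) => [kj|_]; last by rewrite addn0.
  by have := aP (j - k)%N; rewrite subnK// addnC.
move=> j _; rewrite cE /shiftn; have := a2 j; have := a2 (j - k)%N.
by case: (k <= j)%N; lia.
Qed.

Lemma iota0S k : iota 0 k.+1 = iota 0 k ++ [:: k].
Proof. by rewrite -addn1 iotaD. Qed.

Lemma Lk_sum k : Lk k = (\sum_(i <- iota 0 k) 3 ^ i)%N.
Proof.
suff {1}-> : Lk k = (((\sum_(i <- iota 0 k) 3 ^ i).*2) %/ 2)%N.
  by rewrite -muln2 mulnK.
rewrite /Lk; congr (_ %/ _)%N; elim: k => [|k IH]; first by rewrite big_nil.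
rewrite iota0S big_cat big_seq1 /= doubleD -IH expnS.
by have := expn_gt0 3 k; lia.
Qed.

Lemma convn_iotaS a k j :
  convn (iota 0 k.+1) a j = (convn (iota 0 k) a j + shiftn k a j)%N.
Proof. by rewrite /convn iota0S big_cat big_seq1. Qed.

(** For [iota 0 k] the convolution at j sums the window of the last k digits ending at j; moving its
    upper end while keeping its lower end adds just one digit. *)
Lemma convn_iota_rec a k j :
  convn (iota 0 k.+1) a j.+1 = (a j.+1 + convn (iota 0 k) a j)%N.
Proof.
elim: k => [|k IH]; first by rewrite /convn big_seq1 big_nil /shiftn addn0.
by rewrite convn_iotaS IH convn_iotaS addnA /shiftn ltnS subSS.
Qed.

Lemma convn_iota_step a k j :
  (convn (iota 0 k) a j.+1 <= a j.+1 + convn (iota 0 k) a j)%N.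
Proof.
by rewrite -convn_iota_rec convn_iotaS leq_addr.
Qed.

Lemma Sigma3_Lk x a k : (forall j, (a j < 2)%N) -> represents x a ->
  Sigma3 ((Lk k)%:R * x) <-> forall j, (convn (iota 0 k) a j < 2)%N.
Proof.
move=> a2 xa; rewrite Lk_sum; apply: Sigma3_represents.
  exact: represents_convn.
move=> [|j] IH; last first.
  by have := IH j (leqnn _); have := a2 j.+1; have := convn_iota_step a k j; lia.
case: k {IH} => [|k]; first by rewrite /convn big_nil.
rewrite /convn /= big_cons big1_seq ?addn0; first exact: ltnW (a2 0%N).
by move=> i /andP[_]; rewrite mem_iota; case: i.
Qed.

(** Two ones at distance i < k both lie in the window ending at the upper one. The converse grows
    the window by induction on k. *)
Lemma convn_iota_lt2P a k : (forall j, (a j < 2)%N) ->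
  (forall j, (convn (iota 0 k) a j < 2)%N) <->
  (forall i, (0 < i < k)%N -> forall j, (a j + a (j + i) < 2)%N).
Proof.
move=> a2; split=> [aP i /andP[i0 ik] j|aP].
  apply: leq_ltn_trans (aP (j + i)%N).
  rewrite /convn (bigD1_seq i) ?mem_iota ?iota_uniq//=.
  rewrite /shiftn leq_addl addnK leq_add2l.
  rewrite (big_rem 0%N) ?mem_iota ?add0n ?(leq_trans _ ik)//=.
  by rewrite eq_sym -lt0n i0 subn0 leq_addr.
elim: k aP => [|k IH] aP j; first by rewrite /convn big_nil.
have {}IH : (convn (iota 0 k) a j < 2)%N.
  by apply: IH => i /andP[i0 ik]; apply: aP; rewrite i0 ltnW.
rewrite convn_iotaS /shiftn; case: (leqP k j) => [kj|_]; last by rewrite addn0.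
(* If the digit entering the window is a one, every other digit of the window is at distance between
   1 and k from it, hence zero. *)
have := a2 (j - k)%N; case ajk: (a (j - k)%N) => [|[|//]] _; first by rewrite addn0.
rewrite /convn big1_seq// => i /andP[_]; rewrite mem_iota add0n => /andP[_ ik].
rewrite /shiftn (leq_trans (ltnW ik) kj).
have := aP (k - i)%N; rewrite subn_gt0 ik ltnS leq_subr => /(_ isT (j - k)%N).
by rewrite ajk (_ : (j - k + (k - i))%N = (j - i)%N); lia.
Qed.

Lemma C1_NkP x a ks : (forall j, (a j < 2)%N) -> represents x a ->
  C1 [seq Nk k | k <- ks] x <->
  {in ks, forall k j, (a j + a (j + k) < 2)%N}.
Proof.
move=> a2 xa; split=> [[_ xP] k kks|aP].
  by apply/(Sigma3_Nk k a2 xa)/xP; exact: map_f.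
split; first by apply/Sigma3P; exists a.
by move=> _ /mapP[k kks ->]; apply/(Sigma3_Nk k a2 xa)/aP.
Qed.

Lemma C1_Lk n : C1 [:: Lk n.+1] = C1 [seq Nk k | k <- iota 1 n].
Proof.
have key x : Sigma3 x ->
    C1 [:: Lk n.+1] x <-> C1 [seq Nk k | k <- iota 1 n] x.
  move=> /[dup] Sx /Sigma3P[a a2 xa]; rewrite (C1_NkP _ a2 xa).
  have -> : C1 [:: Lk n.+1] x <-> Sigma3 ((Lk n.+1)%:R * x).
    split=> [[_ SL]|SL]; first exact: SL (mem_head _ _).
    by split=> // m; rewrite inE => /eqP->.
  rewrite (Sigma3_Lk _ a2 xa) (convn_iota_lt2P _ a2).
  by split=> aP i hi; apply: aP; move: hi; rewrite mem_iota add1n.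
by apply/seteqP; split=> x /[dup] -[Sx _] /(key x Sx).
Qed.

Lemma subset_C1 (s t : seq nat) : {subset s <= t} -> C1 t `<=` C1 s.
Proof. by move=> st x [Sx xP]; split=> // m /st; exact: xP. Qed.

(** * Covers of Cantor space by cylinders *)

Section CantorCover.
Variable R : realType.
Implicit Types (c w : seq bool).

(* The fair coin-tossing measure of the intersection of the cylinders of the
   words [c] and [w]. *)
Definition cyl_measure c w : R :=
  if take (size c) w == take (size w) c then 2 ^- maxn (size w) (size c) else 0.

Lemma cyl_measure_ge0 c w : 0 <= cyl_measure c w.
Proof. by rewrite /cyl_measure; case: ifP => // _; rewrite invr_ge0 exprn_ge0. Qed.

Lemma cyl_measure_split c w :
  cyl_measure c w =
  cyl_measure c (rcons w false) + cyl_measure c (rcons w true).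
Proof.
rewrite /cyl_measure !size_rcons; case: (leqP (size c) (size w)) => cw.
  rewrite -!cats1 !takel_cat// !(take_oversize cw) !(take_oversize (leqW cw)).
  rewrite (maxn_idPl (leqW cw)); case: ifP => _; last by rewrite addr0.
  by rewrite exprS invfM; lra.
rewrite (maxn_idPr cw).
rewrite !(@take_oversize _ (size c)) ?size_rcons ?(ltnW cw)//.
rewrite (take_nth false)// !eqseq_rcons.
by case: (_ == take _ _); case: (nth _ _ _); rewrite /= ?addr0 ?add0r.
Qed.

(** Let [nu w] be the total mass of the cylinders inside that of [w]. It is additive over the two
    extensions of [w], so one of them preserves [nu w] < 2^-|w|; iterating yields [b]. A prefix of
    [b] equal to some [c i] would contradict this, since the term of [c i] alone reaches the
    bound. *)
Lemma cantor_cover (c : nat -> seq bool) :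
  (\sum_(0 <= i <oo) (2 ^- size (c i))%:E < (1 : R)%:E)%E ->
  exists b : nat -> bool, forall i, mkseq b (size (c i)) != c i.
Proof.
move=> c1; pose nu w := (\sum_(0 <= i <oo) (cyl_measure (c i) w)%:E)%E.
have step w : exists x, (nu w < (2 ^- size w)%:E)%E ->
    (nu (rcons w x) < (2 ^- (size w).+1)%:E)%E.
  apply: contrapT => /forallNP nx.
  have /not_implyP[w1 /negP] := nx false; rewrite -leNgt => w2.
  have /not_implyP[_ /negP] := nx true; rewrite -leNgt => w3.
  move: w1; apply/negP; rewrite -leNgt.
  have -> : nu w = (nu (rcons w false) + nu (rcons w true))%E.
    rewrite /nu -nneseriesD; last 2 first.
    - by move=> *; rewrite lee_fin cyl_measure_ge0.
    - by move=> *; rewrite lee_fin cyl_measure_ge0.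
    by apply: eq_eseriesr => i _; rewrite cyl_measure_split EFinD.
  apply: le_trans (leeD w2 w3); rewrite -EFinD lee_fin exprS invfM; lra.
have [g gP] := choice step.
pose W n := iter n (fun w => rcons w (g w)) [::]; pose b n := g (W n).
have Wb n : W n = mkseq b n by elim: n => // n IH; rewrite mkseqS /b -IH.
have nuW n : (nu (mkseq b n) < (2 ^- n)%:E)%E.
  elim: n => [|n IH].
    rewrite expr0 invr1; apply: le_lt_trans c1; apply: lee_nneseries => i *.
      by rewrite lee_fin cyl_measure_ge0.
    by rewrite /cyl_measure /= take0 max0n eqxx.
  by have := gP (mkseq b n); rewrite size_mkseq mkseqS /b -Wb; apply; rewrite Wb.
exists b => i; apply/negP => /eqP bc; have := nuW (size (c i)).
apply/negP; rewrite -leNgt /nu bc.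
have cc : (cyl_measure (c i) (c i))%:E = (2 ^- size (c i))%:E.
  by rewrite /cyl_measure eqxx maxnn.
apply: le_trans (nneseries_lim_ge i.+1 _); last first.
  by move=> *; rewrite lee_fin cyl_measure_ge0.
rewrite big_nat_recr//= cc leeDr// sume_ge0// => *.
by rewrite lee_fin cyl_measure_ge0.
Qed.

End CantorCover.

(** * Monotonicity of the dimension and mass distribution *)

Section HausdorffDim.
Variable R : realType.

Lemma hausdorff_dim_ge0 (T : metricType R) (A : set T) :
  (0 <= hausdorff_dim A)%E.
Proof. by apply: le_ereal_inf_tmp => _ [s [s0 _] <-]; rewrite lee_fin. Qed.

Lemma diam_pow_ge0 (T : metricType R) s (U : set T) : (0 <= diam_pow s U)%E.
Proof. by rewrite /diam_pow; case: ifP => // _; exact: poweR_ge0. Qed.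

Lemma hausdorff_dim_le (T : metricType R) (A B : set T) :
  A `<=` B -> (hausdorff_dim A <= hausdorff_dim B)%E.
Proof.
move=> AB; apply: ereal_inf_le_tmp => _ [s [s0 sB] <-]; exists s => //; split=> //.
apply/eqP; rewrite eq_le; apply/andP; split.
  rewrite -sB; apply: ge_ereal_sup => _ [e e0 <-].
  apply: le_trans (ereal_sup_ubound _); last by exists e.
  apply: ereal_inf_le_tmp => _ [U [BU Ue] <-]; exists U => //; split=> //.
  exact: subset_trans BU.
apply: le_trans (ereal_sup_ubound _); last by exists 1 => //=.
apply: le_ereal_inf_tmp => _ [U _ <-]; apply: nneseries_ge0 => n _ _.
exact: diam_pow_ge0.
Qed.

Lemma mdist_le_diam (T : metricType R) (U : set T) x y :
  U x -> U y -> ((mdist x y)%:E <= diam U)%E.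
Proof.
move=> Ux Uy; rewrite /diam le_max; apply/orP; right.
by apply: ereal_sup_ubound; exists x => //; exists y.
Qed.

(* Mass distribution principle for the image under [phi] of the coin-tossing
   measure: a ball of radius [3 ^- n] has measure at most [2 ^- F n]. *)
Lemma dim3_ge (A : set Z3) (phi : (nat -> bool) -> Z3) (F : nat -> nat) (d : R) :
  (forall b, A (phi b)) ->
  (forall n b b', res (phi b) n = res (phi b') n ->
    mkseq b (F n) = mkseq b' (F n)) ->
  (forall m, exists n, (m <= F n)%N) ->
  (forall n, 2 ^- F n <= (3 ^- n) `^ d) ->
  (d%:E <= dim3 R A)%E.
Proof.
move=> Aphi resF Fy Fd; apply: le_ereal_inf_tmp => _ [s [s0 sA] <-].
rewrite lee_fin leNgt; apply/negP => sd.
(* The value 1/2 leaves room for a total error of 1/2 below; the scale 1/3 keeps all diameters below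
   1. *)
have : (hausdorff_pre s 3^-1 A < 2^-1%:E)%E.
  apply: (@le_lt_trans _ _ 0%E); last by rewrite lte_fin.
  by rewrite -sA; apply: ereal_sup_ubound; exists 3^-1 => //=.
move=> /ereal_inf_lt[_ [U [AU U3] <-] U2].
(* Each covering set pulls back into a single cylinder, whose mass is controlled up to a summable
   error. *)
have cov i : exists c : seq bool,
    ((2 ^- size c)%:E <= diam_pow s (U i) + (2^-1 / (2 ^ i.+1)%:R)%:E)%E /\
    forall b, U i (phi b) -> mkseq b (size c) = c.
  (* Long words fit in the error term alone; this settles sets missing the image of [phi] and sets
     of diameter 0. *)
  have small (c : seq bool) : (i.+2 <= size c)%N ->
      ((2 ^- size c)%:E <= diam_pow s (U i) + (2^-1 / (2 ^ i.+1)%:R)%:E)%E.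
    move=> ic; apply: le_trans (leeDr _ (diam_pow_ge0 _ _)).
    rewrite lee_fin -invfM natrX -exprS lef_pV2 ?posrE ?exprn_gt0//.
    by rewrite ler_eXn2l ?ltr1n.
  have [[b0 Ub0]|nU] := pselect (exists b0, U i (phi b0)); last first.
    exists (nseq i.+2 false); split; first by apply: small; rewrite size_nseq.
    by move=> b Ub; exfalso; apply: nU; exists b.
  have diamP : exists2 r, diam (U i) = r%:E & 0 <= r <= 3^-1.
    have := U3 i; have : (0 <= diam (U i))%E by rewrite /diam le_max lexx.
    by case: (diam (U i)) => // r; rewrite !lee_fin => r0 r3; exists r => //; rewrite r0.
  have [r Ur /andP[r0 r3]] := diamP.
  have Udist b : U i (phi b) -> dist3 R (phi b) (phi b0) <= r.
    by move=> Ub; rewrite -lee_fin -Ur; exact: mdist_le_diam.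
  suff [n [nU nr]] : exists n,
      (forall b, U i (phi b) -> res (phi b) n = res (phi b0) n) /\
      ((2 ^- F n)%:E <= diam_pow s (U i) + (2^-1 / (2 ^ i.+1)%:R)%:E)%E.
    exists (mkseq b0 (F n)); rewrite size_mkseq; split=> // b Ub.
    exact/resF/nU.
  move: r0; rewrite le_eqVlt => /predU1P[r0|r0].
    have [n nF] := Fy i.+2; exists n; split.
      move=> b /Udist; rewrite -r0 => b0r.
      by rewrite (@dist3_eq0 R (phi b) (phi b0))//; apply: le_anti; rewrite b0r dist3_ge0.
    by have := small (mkseq b0 (F n)); rewrite size_mkseq; apply.
  have ex : exists n, (3 ^- n : R) <= r.
    have /cvgr_dist_lt/(_ r r0)[N _ /(_ N (leqnn N))] :
        (fun n => (3^-1 : R) ^+ n) @ \oo --> (0 : R).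
      by apply: cvg_expr; rewrite gtr0_norm ?invf_lt1 ?ltr1n ?invr_gt0.
    rewrite /= sub0r normrN ger0_norm ?exprn_ge0 ?invr_ge0// exprVn => /ltW.
    by exists N.
  (* The least n with 3^-n <= r is positive, so r < 3^-(n-1) and points at distance at most r agree
     modulo 3^n. *)
  have rl1 : r < 1 by apply: le_lt_trans r3 _; rewrite invf_lt1 ?ltr1n.
  case: (ex_minnP ex) => -[|n] nr nmin.
    by move: nr; rewrite expr0 invr1 leNgt rl1.
  exists n.+1; split.
    move=> b /Udist br; apply/(@dist3_lt R)/(le_lt_trans br).
    by rewrite ltNge; apply/negP => /nmin; rewrite ltnn.
  apply: le_trans (leeDl _ _); last by rewrite lee_fin divr_ge0.
  rewrite /diam_pow; case: asboolP => [U0|_].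
    by move: Ub0; rewrite U0.
  rewrite Ur poweR_EFin lee_fin (le_trans (Fd _))//.
  apply: (@le_trans _ _ (r `^ d)).
    by apply: ge0_ler_powR; rewrite ?nnegrE ?(ltW r0)// (le_trans s0 (ltW sd)).
  by apply: ger_powR; rewrite ?r0 ?(ltW rl1)// ltW.
have [c cP] := choice cov.
have [|b bP] := @cantor_cover R c.
  apply: (@le_lt_trans _ _ (\sum_(0 <= i <oo) diam_pow s (U i) + 2^-1%:E)%E).
    apply: le_trans (epsilon_trick _ _ _); last 2 first.
    - by move=> i; exact: diam_pow_ge0.
    - by [].
    by apply: lee_nneseries => [i _ _|i _]; [rewrite lee_fin|case: (cP i)].
  rewrite [in ltRHS](_ : 1 = 2^-1 + 2^-1); last by lra.
  by rewrite EFinD lteD2rE.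
have [i _ Ui] := AU _ (Aphi b); have [_ /(_ b Ui)] := cP i.
by apply/eqP.
Qed.

End HausdorffDim.

(** * A block-structured subset of C(1, N_k, ..., N_{k+n-1}) *)

Section BlockSubset.

Definition Z3_of_digits (a : nat -> nat) : Z3 :=
  Z3_make (fun n => etrans (modz_pow3 (digsum a n) n)
    (etrans (congr1 Posz (esym (digsum_modn a (leqnSn n))))
            (esym (modz_pow3 (digsum a n.+1) n)))).

Lemma represents_of_digits a : represents (Z3_of_digits a) a.
Proof. by move=> n; exact: modz_pow3. Qed.

Lemma represents_inj x y a b n :
  (forall j, (a j < 2)%N) -> (forall j, (b j < 2)%N) ->
  represents x a -> represents y b -> res x n = res y n ->
  forall j, (j < n)%N -> a j = b j.
Proof.
move=> a2 b2 xa yb xy j jn; apply: digsum_inj => [i _|i _|].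
- exact: ltnW (a2 i).
- exact: ltnW (b2 i).
- by have := res_le jn xy; rewrite xa yb => -[].
Qed.

Variables (k n : nat).
Hypotheses (k_gt0 : (0 < k)%N) (n_gt0 : (0 < n)%N).

(* Blocks of [k] free digits are separated by gaps of [k + n] zeros: two ones are
   at distance less than [k] or at least [k + n]. *)
Let p := (k + (k + n))%N.

Definition block_digits (b : nat -> bool) (j : nat) : nat :=
  ((j %% p < k)%N && b (j %/ p * k + j %% p)%N).

Definition block_point b := Z3_of_digits (block_digits b).

Lemma block_digits_lt2 b j : (block_digits b j < 2)%N.
Proof. by rewrite /block_digits ltnS leq_b1. Qed.

Lemma block_point_C1 b : C1 [seq Nk j | j <- iota k n] (block_point b).
Proof.
apply/(C1_NkP _ (block_digits_lt2 b) (represents_of_digits _)) => i.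
rewrite mem_iota => /andP[ki ikn] j.
have [jk|jk] := ltnP (j %% p) k; last first.
  by rewrite {1}/block_digits (ltnNge (_ %% _)) jk; exact: block_digits_lt2.
(* Since j mod p < k and i < k + n, the sum stays below p = 2k + n; as i >= k, it lands in the gap
   of the same block. *)
rewrite {2}/block_digits (_ : ((j + i) %% p)%N = (j %% p + i)%N); last first.
  by rewrite -modnDml modn_small//; move: jk ikn; rewrite /p; lia.
rewrite (ltnNge (_ + i)) (leq_trans ki (leq_addl _ _)) addn0.
exact: block_digits_lt2.
Qed.

Definition free_count (m : nat) : nat := (m %/ p * k + minn (m %% p) k)%N.

Lemma block_point_res m b b' :
  res (block_point b) m = res (block_point b') m ->
  mkseq b (free_count m) = mkseq b' (free_count m).
Proof.
move=> bb'; apply/eq_in_map => t; rewrite mem_iota add0n leq0n /free_count => tm.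
have p_gt0 : (0 < p)%N by rewrite /p; lia.
have tk : (t %% k < k)%N by rewrite ltn_mod.
have kp : (k <= p)%N by rewrite /p leq_addr.
have tE := divn_eq t k; have mE := divn_eq m p; have mp := ltn_pmod m p_gt0.
(* The place that carries the free bit number t. *)
set j := (t %/ k * p + t %% k)%N.
have jm : (j < m)%N.
  rewrite /j; have [tlt|tge] := ltnP (t %/ k) (m %/ p); first by nia.
  have -> : (t %/ k = m %/ p)%N by nia.
  nia.
have := represents_inj (block_digits_lt2 b) (block_digits_lt2 b')
  (represents_of_digits _) (represents_of_digits _) bb' jm.
rewrite /block_digits /j modnMDl (@modn_small (t %% k)) ?(leq_trans tk kp)// tk.
rewrite divnMDl// (@divn_small (t %% k)) ?(leq_trans tk kp)// addn0 -tE.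
by case: (b t); case: (b' t).
Qed.

Lemma free_count_unbounded m : exists N, (m <= free_count N)%N.
Proof.
exists (m * p)%N; rewrite /free_count mulnK ?modnMl ?min0n ?addn0.
  exact: leq_pmulr.
by rewrite /p; lia.
Qed.

(** Free places come first in each block, so their density in any prefix is at least k / p. *)
Lemma free_count_ge m : (m * k <= free_count m * p)%N.
Proof.
have p_gt0 : (0 < p)%N by rewrite /p; lia.
have kp : (k <= p)%N by rewrite /p leq_addr.
have mE := divn_eq m p; have mp := ltn_pmod m p_gt0.
rewrite /free_count {1}mE; case: leqP; nia.
Qed.

Lemma block_dim (R : realType) :
  ((k%:R / p%:R * log3 2)%:E <= dim3 R (C1 [seq Nk j | j <- iota k n]))%E.
Proof.
apply: (@dim3_ge R _ block_point free_count) => [||//|m].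
- exact: block_point_C1.
- exact: block_point_res.
- exact: free_count_unbounded.
have p_gt0 : 0 < p%:R :> R by rewrite ltr0n /p; lia.
have ln3 : 0 < ln 3 :> R by rewrite ln_gt0// ltr1n.
rewrite -(powR_invn m (ler0n R 3)) -powRrM -(powR_invn _ (ler0n R 2)).
(* Taking base 2 through 3^(log_3 2) = 2 reduces the bound to [free_count_ge]. *)
have -> : (3 : R) `^ (- m%:R * (k%:R / p%:R * log3 2)) =
    2 `^ (- (m%:R * k%:R / p%:R)).
  rewrite /powR !pnatr_eq0/=; congr expR; rewrite /log3.
  by field; rewrite !gt_eqF.
apply: ler_powR; first by rewrite ler1n.
by rewrite lerN2 ler_pdivrMr// -!natrM ler_nat free_count_ge.
Qed.

End BlockSubset.

(** * Limits in k and the sets [Estar] *)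

Lemma log3_2_ge0 (R : realType) : 0 <= log3 2 :> R.
Proof. by rewrite divr_ge0// ln_ge0// ler1n. Qed.

(** The deficit of k / (2k + n) from 1/2 is weakened to n / (k + 1), which visibly tends to 0. At k
    = 0 there are no free digits, but the bound is then nonpositive. *)
Lemma dim3_C1_ge (R : realType) k n : (0 < n)%N ->
  (((2^-1 - n%:R * harmonic k) * log3 2)%:E <=
    dim3 R (C1 [seq Nk j | j <- iota k n]))%E.
Proof.
move=> n0; case: k => [|k].
  apply: le_trans (hausdorff_dim_ge0 _); rewrite lee_fin.
  rewrite mulr_le0_ge0 ?log3_2_ge0// /harmonic /= invr1 mulr1 subr_le0.
  by rewrite (@le_trans _ _ 1) ?invf_le1 ?ler1n.
apply: le_trans (block_dim (ltn0Sn k) n0 R); rewrite lee_fin.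
rewrite ler_wpM2r ?log3_2_ge0// /harmonic /=.
have k0 : 0 <= k%:R :> R by rewrite ler0n.
have n1 : 1 <= n%:R :> R by rewrite ler1n.
rewrite !natrD -!(natr1 k.+1) -!(natr1 k) ler_pdivlMr; last by lra.
rewrite -subr_ge0.
set x : R := k%:R in k0 *; set y : R := n%:R in n1 *.
have -> : x + 1 - (2^-1 - y / (x + 1 + 1)) * (x + 1 + (x + 1 + y)) =
    y * (3 / 2 * x + 1 + y) / (x + 1 + 1).
  by field; lra.
by rewrite divr_ge0 ?mulr_ge0//; lra.
Qed.

Lemma cvg_dim_bound (R : realType) n :
  (((2^-1 - n%:R * harmonic k) * log3 2)%:E : \bar R) @[k --> \oo] -->
  ((2^-1 * log3 2)%:E : \bar R).
Proof.
apply: cvg_EFin; first by apply: nearW.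
apply: cvgMl.
rewrite -[X in _ --> X]subr0; apply: cvgB; first exact: cvg_cst.
rewrite -[X in _ --> X](mulr0 n%:R).
exact: cvgMr cvg_harmonic.
Qed.

Lemma limn_einf_ge (R : realType) (u v : (\bar R)^nat) (l : \bar R) :
  v @ \oo --> l -> (forall n, (v n <= u n)%E) -> (l <= limn_einf u)%E.
Proof.
move=> vl vu; rewrite -(cvg_limn_einf_sup vl).1 !limn_einf_lim.
apply: lee_lim; [exact: is_cvg_einfs|exact: is_cvg_einfs|].
apply: nearW => n; apply: le_ereal_inf_tmp => _ [m nm <-].
by apply: le_trans (vu m); apply: ereal_inf_lbound; exists m.
Qed.

Lemma path_ltn_le_last x s k : path ltn x s -> k \in x :: s -> (k <= last x s)%N.
Proof.
elim: s x k => [|y s IH] x k /=; first by move=> _; rewrite inE => /eqP->.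
move=> /andP[xy ys]; rewrite inE => /predU1P[->|]; last exact: IH.
by apply: leq_trans (ltnW xy) _; apply: IH; rewrite ?mem_head.
Qed.

Lemma C1_Nk_subset_Estar m k :
  (0 < m)%N -> C1 [seq Nk j | j <- iota m k] `<=` Estar k.+1.
Proof.
move=> m0 x [Sx Nx]; pose M := 1%N :: [seq Nk j | j <- iota m k].
have sM : size M == k.+1 by rewrite /= size_map size_iota.
have Nk1 j : (m <= j)%N -> (1 < Nk j)%N by rewrite /Nk => _; have := expn_gt0 3 j; lia.
exists (Tuple sM); split=> //=.
  rewrite path_sortedE; last exact: ltn_trans.
  apply/andP; split.
    by apply/allP => _ /mapP[j + ->]; rewrite mem_iota => /andP[/Nk1].
  apply: (homo_sorted (e := ltn)) (iota_ltn_sorted _ _) => i j ij.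
  by rewrite /Nk /= ltn_add2r ltn_exp2l.
move=> i; rewrite inE => /predU1P[->|iN]; first by rewrite mul1r.
split; last exact: Nx.
move: iN => /mapP[[|j] + ->]; first by rewrite mem_iota leqNgt m0.
by rewrite /Nk expnS mulnC modnMDl.
Qed.

(** Truncate the tuple of multipliers. Nesting starts at index 1: [head 0%N] of the empty tuple is
    0, so [Estar 0] is empty. *)
Lemma Estar_nonincreasing k : Estar k.+2 `<=` Estar k.+1.
Proof.
move=> x [M [M1 Msorted MP]].
have sM : size (take k.+1 M) == k.+1 by rewrite size_takel ?size_tuple.
exists (Tuple sM); split=> /=.
- by move: M1; case: (tval M).
- exact: take_sorted.
- by move=> m /mem_take; exact: MP.
Qed.

(** * Numerical bounds for log_3 2, and the theorem *)

Lemma ln_lt_pow (R : realType) (a b m n : nat) :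
  (0 < a)%N -> (0 < b)%N -> (a ^ m < b ^ n)%N ->
  m%:R * ln a%:R < n%:R * ln b%:R :> R.
Proof.
move=> a0 b0 ab; rewrite !mulr_natl -!lnXn ?ltr0n// -!natrX.
by rewrite ltr_ln ?posrE ?ltr0n ?expn_gt0 ?a0 ?b0// ltr_nat.
Qed.

Lemma log3_gt (R : realType) (m n : nat) : (0 < n)%N -> (3 ^ m < 2 ^ n)%N ->
  m%:R / n%:R < (log3 2 : R).
Proof.
move=> n0 /(ln_lt_pow R (ltn0Sn 2) (ltn0Sn 1)) mn.
have ln3 : 0 < ln 3 :> R by rewrite ln_gt0// ltr1n.
by rewrite /log3 ltr_pdivlMr// mulrAC ltr_pdivrMr ?ltr0n// [ltRHS]mulrC.
Qed.

Lemma log3_lt (R : realType) (m n : nat) : (0 < n)%N -> (2 ^ n < 3 ^ m)%N ->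
  (log3 2 : R) < m%:R / n%:R.
Proof.
move=> n0 /(ln_lt_pow R (ltn0Sn 1) (ltn0Sn 2)) mn.
have ln3 : 0 < ln 3 :> R by rewrite ln_gt0// ltr1n.
by rewrite /log3 ltr_pdivrMr// mulrAC ltr_pdivlMr ?ltr0n// [ltLHS]mulrC.
Qed.

Lemma pow3_306_lt : (3 ^ 306 < 2 ^ 485)%N.
Proof. lia. Qed.

Lemma pow2_1054_lt : (2 ^ 1054 < 3 ^ 665)%N.
Proof. lia. Qed.

(* 306 / 485 and 665 / 1054 are continued fraction convergents of log_3 2. *)
Lemma log3_2_bounds (R : realType) :
  306 / 485 < (log3 2 : R) < 665 / 1054.
Proof.
apply/andP; split.
  exact: (log3_gt R (ltn0Sn 484) pow3_306_lt).
exact: (log3_lt R (ltn0Sn 1053) pow2_1054_lt).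
Qed.

Theorem theorem4p8 (R : realType) :
  (forall ks : seq nat, ks <> [::] -> all (leq 1) ks -> sorted ltn ks ->
     (dim3 R (C1 [:: Lk (last 0%N ks).+1]) <=
      dim3 R (C1 [seq Nk k | k <- ks]))%E) /\
  (forall n : nat, (1 <= n)%N ->
     dim3 R (C1 [seq Nk j | j <- iota 1 n]) = dim3 R (C1 [:: Lk n.+1])) /\
  (forall n : nat, (1 <= n)%N ->
     ((2^-1 * log3 2)%:E <=
      limn_einf (fun k => dim3 R (C1 [seq Nk j | j <- iota k n])))%E) /\
  `|2^-1 * log3 2 - (315 / 10 ^+ 3 + 464 / 10 ^+ 6)| < (10 ^- 6 : R) /\
  ((2^-1 * log3 2)%:E <= Gamma_star R)%E.
Proof.
split.
  move=> [//|k ks] _ /allP ks1 ks_sorted; rewrite C1_Lk.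
  (* The increasing list lies in 1, ..., [last 0%N ks], so its conditions are among those for N_1,
     ..., N_last. *)
  apply/hausdorff_dim_le/subset_C1 => _ /mapP[j jks ->]; apply: map_f.
  by rewrite mem_iota add1n ltnS ks1//= path_ltn_le_last.
split; first by move=> n _; rewrite C1_Lk.
split.
  move=> n n0; apply: (limn_einf_ge (@cvg_dim_bound R n)) => k.
  exact: dim3_C1_ge.
split.
  have /andP[] := log3_2_bounds R; set x := log3 2 => x1 x2.
  by rewrite ltr_norml; apply/andP; split; lra.
apply: lime_ge.
  apply/cvg_ex; eexists; rewrite -cvg_shiftS.
  apply: ereal_nonincreasing_cvgn; apply/nonincreasing_seqP => k.
  exact/hausdorff_dim_le/Estar_nonincreasing.
(* Starting at index 2 leaves at least one N_j beside M_1 = 1. *)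
exists 2%N => // -[|[|k]] // _.
(* With k fixed, [Estar k.+2] contains the sets for all starting indices m > 0, so its dimension
   dominates the limit in m of their bounds. *)
rewrite -(cvg_lim _ (@cvg_dim_bound R k.+1))//.
apply: lime_le; first by apply/cvg_ex; eexists; exact: cvg_dim_bound.
exists 1%N => // m /= m0; apply: le_trans (dim3_C1_ge R m (ltn0Sn k)) _.
exact/hausdorff_dim_le/C1_Nk_subset_Estar.
Qed.
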